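(* Let $\Sigma$ be a finite alphabet and $L\subseteq\Sigma^*$. Then $L$ is accepted by a 1-way quantum finite automaton with probability bounded away from $1/2$ if and only if the relation $L\times\{0\}\ \cup\ \overline{L}\times\{1\}\subseteq \Sigma^*\times\{0,1\}^*$ (where $\overline{L}=\Sigma^*\setminus L$) is computed by some quantum finite state transducer with an isolated cutpoint.
   Context: A quantum finite state transducer (qfst) is a tuple $T=(Q,\Sigma_1,\Sigma_2,V,f,q_0,Q_{\rm acc},Q_{\rm rej})$ with $Q$ a finite set of states, $\Sigma_1,\Sigma_2$ finite input/output alphabets, $q_0\in Q$, and disjoint sets $Q_{\rm acc},Q_{\rm rej}\subseteq Q$ of accepting and rejecting states; $Q_{\rm non}=Q\setminus(Q_{\rm acc}\cup Q_{\rm rej})$. For each $a\in\Sigma_1\cup\{\ddagger,\$\}$ (end markers $\ddagger,\$\notin\Sigma_1$) there is a unitary $V_a$ on $\ell^2(Q)$, $V_a|q\rangle=\sum_p (V_a)_{qp}|p\rangle$, and an output function $f_a:Q\to\Sigma_2^*$; $V_\$$ maps $\mathrm{span}\,Q_{\rm non}$ into $\mathrm{span}(Q_{\rm acc}\cup Q_{\rm rej})$. On input $v\in\Sigma_1^*$ the machine reads $\ddagger v\$$ symbol by symbol. Its non-halting part is an (unnormalized) vector $\psi=\sum_{q,w}\alpha_{qw}|q\rangle\otimes|w\rangle\in\ell^2(Q\times\Sigma_2^* )$, initially $|q_0\rangle\otimes|\epsilon\rangle$. Reading $a$ maps $\psi$ to $\psi'=\sum_{q,w}\alpha_{qw}V_a|q\rangle\otimes|w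 f_a(q)\rangle$; then for each $x\in\Sigma_2^*$ the squared norm of the component of $\psi'$ on $\mathrm{span}(Q_{\rm acc})\otimes|x\rangle$ is added to the probability of accepting with output $x$, the squared norm of the component of $\psi'$ on $\mathrm{span}(Q_{\rm rej})\otimes\ell^2(\Sigma_2^* )$ is added to the rejection probability, and the computation continues with the projection of $\psi'$ onto $\mathrm{span}(Q_{\rm non})\otimes\ell^2(\Sigma_2^* )$. $T(w|v)$ denotes the total probability of accepting with output $w$ on input $v$. A relation $\mathcal R\subseteq\Sigma_1^*\times\Sigma_2^*$ is computed by $T$ with isolated cutpoint if there are $0<\alpha<1$ and $\varepsilon>0$ such that for all $v,w$: $(v,w)\in\mathcal R\Rightarrow T(w|v)\ge\alpha+\varepsilon$ and $(v,w)\notin\mathcal R\Rightarrow T(w|v)\le\alpha-\varepsilon$. A 1-way quantum finite automaton (in the Kondacs–Watrous measure-many sense) is the same device without output tape and output functions: acceptance/rejection probabilities accumulate from the halting measurement after each symbol of $\ddagger v\$$. It accepts $L$ with probability bounded away from $1/2$ if there is $\delta>0$ such that words in $L$ are accepted with probability $\ge 1/2+\delta$ and words not in $L$ with probability $\le 1/2-\delta$. *)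

(* Defs.v *)
From mathcomp Require Import all_boot all_algebra.
From mathcomp Require Import reals complex.
Set Implicit Arguments. Unset Strict Implicit. Unset Printing Implicit Defensive.
Import GRing.Theory Num.Theory.
Local Open Scope ring_scope.
Local Open Scope complex_scope.

Inductive tsym (S : Type) := Sym of S | LEnd | REnd.
Arguments LEnd {S}. Arguments REnd {S}.

Definition tape (S : Type) (v : seq S) : seq (tsym S) :=
  LEnd :: map (@Sym S) v ++ [:: REnd].

(* Kind of a state: accepting, rejecting or non-halting (makes Q_acc, Q_rej disjoint). *)
Inductive skind := Acc | Rej | Non.
Definition skind_eqb (a b : skind) : bool :=
  match a, b with Acc, Acc | Rej, Rej | Non, Non => true | _, _ => false end.

Section Machines.
Variable R : realType.
Local Notation C := R[i].

Definition sqmod (z : C) : R := (@complex.Re R z) ^+ 2 + (@complex.Im R z) ^+ 2.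

Definition unitary n (V : 'M[C]_n) : Prop := V *m (map_mx conjc V)^T = 1%:M.

(* Quantum finite state transducer with states 'I_n, input alphabet S1,
   output alphabet S2.  (V a) q p is the amplitude (V_a)_{qp}: V_a|q> = sum_p (V_a)_{qp}|p>. *)
Record qfst (S1 S2 : Type) := QFST {
  qfst_n : nat;
  qfst_V : tsym S1 -> 'M[C]_qfst_n;
  qfst_f : tsym S1 -> 'I_qfst_n -> seq S2;
  qfst_q0 : 'I_qfst_n;
  qfst_kind : 'I_qfst_n -> skind
}.
Arguments qfst_n {S1 S2} q.
Arguments qfst_V {S1 S2} q _.
Arguments qfst_f {S1 S2} q _ _.
Arguments qfst_q0 {S1 S2} q.
Arguments qfst_kind {S1 S2} q _.

Definition qfst_wf (S1 S2 : Type) (T : qfst S1 S2) : Prop :=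
  (forall a, unitary (qfst_V T a)) /\
  (forall q p, qfst_kind T q = Non -> qfst_kind T p = Non ->
               qfst_V T REnd q p = 0).

Section QFSTRun.
Variables (S1 : Type) (S2 : eqType) (T : qfst S1 S2).
Local Notation n := (qfst_n T).
Local Notation V := (qfst_V T).
Local Notation f := (qfst_f T).

(* A vector of l^2(Q x S2^* ), represented as the map  w |-> (row vector of alpha_{q w})_q. *)
Definition qvec := seq S2 -> 'rV[C]_n.

Definition qvec_init : qvec :=
  fun x => if x == [::] then delta_mx 0 (qfst_q0 T) else 0.

(* psi' = sum_{q,w} alpha_{qw} V_a|q> ⊗ |w f_a(q)>.  A pair (q,w) contributes to the
   output x iff w ++ f_a q = x, so w is one of the prefixes take k x, k <= size x. *)
Definition qvec_evolve (a : tsym S1) (psi : qvec) : qvec :=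
  fun x => \sum_(k < (size x).+1) \sum_(q < n)
     (if take k x ++ f a q == x then psi (take k x) 0 q *: row q (V a) else 0).

Definition qvec_proj_non (psi : qvec) : qvec :=
  fun x => \row_p (if skind_eqb (qfst_kind T p) Non then psi x 0 p else 0).

Definition acc_mass (psi : qvec) (x : seq S2) : R :=
  \sum_(p < n | skind_eqb (qfst_kind T p) Acc) sqmod (psi x 0 p).

Fixpoint qfst_acc_run (psi : qvec) (s : seq (tsym S1)) (x : seq S2) : R :=
  match s with
  | [::] => 0
  | a :: s' => let psi' := qvec_evolve a psi in
               acc_mass psi' x + qfst_acc_run (qvec_proj_non psi') s' x
  end.

Definition qfst_prob (v : seq S1) (w : seq S2) : R :=
  qfst_acc_run qvec_init (tape v) w.
End QFSTRun.

Definition computes_isolated (S1 S2 : eqType) (T : qfst S1 S2)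
    (Rel : seq S1 -> seq S2 -> Prop) : Prop :=
  exists (alpha eps : R), 0 < alpha < 1 /\ 0 < eps /\
    forall v w, (Rel v w -> alpha + eps <= qfst_prob T v w) /\
                (~ Rel v w -> qfst_prob T v w <= alpha - eps).

(* 1-way (measure-many, Kondacs–Watrous) quantum finite automaton *)
Record qfa (S : Type) := QFA {
  qfa_n : nat;
  qfa_V : tsym S -> 'M[C]_qfa_n;
  qfa_q0 : 'I_qfa_n;
  qfa_kind : 'I_qfa_n -> skind
}.
Arguments qfa_n {S} q.
Arguments qfa_V {S} q _.
Arguments qfa_q0 {S} q.
Arguments qfa_kind {S} q _.

Definition qfa_wf (S : Type) (M : qfa S) : Prop :=
  (forall a, unitary (qfa_V M a)) /\
  (forall q p, qfa_kind M q = Non -> qfa_kind M p = Non -> qfa_V M REnd q p = 0).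

Section QFARun.
Variables (S : Type) (M : qfa S).
Fixpoint qfa_acc_run (psi : 'rV[C]_(qfa_n M))
    (s : seq (tsym S)) : R :=
  match s with
  | [::] => 0
  | a :: s' => let psi' := psi *m qfa_V M a in
      (\sum_(p < qfa_n M | skind_eqb (qfa_kind M p) Acc) sqmod (psi' 0 p)) +
      qfa_acc_run (\row_p (if skind_eqb (qfa_kind M p) Non then psi' 0 p else 0)) s'
  end.
End QFARun.
Arguments qfa_acc_run {S} M psi s.

Definition qfa_prob (S : Type) (M : qfa S) (v : seq S) : R :=
  qfa_acc_run M (delta_mx 0 (qfa_q0 M)) (tape v).

Definition qfa_accepts_bounded (S : Type) (M : qfa S) (L : seq S -> Prop) : Prop :=
  exists delta : R, 0 < delta /\
    forall v, (L v -> 1/2 + delta <= qfa_prob M v) /\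
              (~ L v -> qfa_prob M v <= 1/2 - delta).
End Machines.

Definition lang_rel (S : Type) (L : seq S -> Prop) (v : seq S) (w : seq bool) : Prop :=
  (L v /\ w = [:: false]) \/ (~ L v /\ w = [:: true]).

(* Main.v *)
Require Import Defs.
From mathcomp Require Import all_boot all_order all_algebra.
From mathcomp Require Import reals complex boolp ring lra.

(* From a transducer to an automaton: for a letter b, an automaton tracking the output
   tape while it is a prefix of [:: b] accepts v with probability T(b|v).  Tossing a fair
   coin between accepting on output 0 and rejecting on output 1 gives acceptance
   probability 1/2 + (T(0|v) - T(1|v))/2, which is at least eps away from 1/2.

   From an automaton to a transducer: the output is written before the step that halts,
   so the verdict must be known one step early.  The transducer delays halting by one
   step and stores the surviving amplitude with the unitary of $ already applied, undoing
   it whenever another letter shows up; when $ is really read, the basis state tells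
   which verdict to write. *)

Set Implicit Arguments. Unset Strict Implicit. Unset Printing Implicit Defensive.
Import Order.TTheory GRing.Theory Num.Theory.
Local Open Scope ring_scope.
Local Open Scope complex_scope.

Arguments qfa_n {R S} q.
Arguments qfa_V {R S} q _.
Arguments qfa_q0 {R S} q.
Arguments qfa_kind {R S} q _.
Arguments qfst_n {R S1 S2} q.
Arguments qfst_V {R S1 S2} q _.
Arguments qfst_f {R S1 S2} q _ _.
Arguments qfst_q0 {R S1 S2} q.
Arguments qfst_kind {R S1 S2} q _.

(** * Functions on a disjoint union of two state sets *)

Section SumFun.
Variables (X : Type) (m n : nat).

Definition sum_fun (f : 'I_m -> X) (g : 'I_n -> X) (i : 'I_(m + n)) : X :=
  match split i with inl j => f j | inr j => g j end.

Lemma sum_fun_lshift f g i : sum_fun f g (lshift n i) = f i.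
Proof. by rewrite /sum_fun (unsplitK (inl i)). Qed.

Lemma sum_fun_rshift f g i : sum_fun f g (rshift m i) = g i.
Proof. by rewrite /sum_fun (unsplitK (inr i)). Qed.

End SumFun.

(** * Adjoints, unitary blocks, coordinate projections and squared norms *)

Section Linear.
Variable R : realType.
Local Notation C := R[i].

Definition dag m n (A : 'M[C]_(m, n)) : 'M[C]_(n, m) := (map_mx conjc A)^T.

Lemma dag_mul m n p (A : 'M[C]_(m, n)) (B : 'M[C]_(n, p)) :
  dag (A *m B) = dag B *m dag A.
Proof. by rewrite /dag map_mxM trmx_mul. Qed.

Lemma dag_block m1 m2 n1 n2 (A : 'M[C]_(m1, n1)) B D (E : 'M_(m2, n2)) :
  dag (block_mx A B D E) = block_mx (dag A) (dag D) (dag B) (dag E).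
Proof. by rewrite /dag map_block_mx tr_block_mx. Qed.

Lemma dag_row_mx m n1 n2 (A : 'M[C]_(m, n1)) (B : 'M_(m, n2)) :
  dag (row_mx A B) = col_mx (dag A) (dag B).
Proof. by rewrite /dag map_row_mx tr_row_mx. Qed.

Lemma dag0 m n : dag (0 : 'M_(m, n)) = 0.
Proof. by rewrite /dag map_mx0 trmx0. Qed.

Lemma dag1 n : dag (1%:M : 'M_n) = 1%:M.
Proof. by rewrite /dag map_mx1 trmx1. Qed.

Lemma dagB m n (A B : 'M[C]_(m, n)) : dag (A - B) = dag A - dag B.
Proof. by apply/matrixP => i j; rewrite !mxE rmorphB. Qed.

Lemma dagD m n (A B : 'M[C]_(m, n)) : dag (A + B) = dag A + dag B.
Proof. by apply/matrixP => i j; rewrite !mxE rmorphD. Qed.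

Lemma dagZ m n c (A : 'M[C]_(m, n)) : dag (c *: A) = conjc c *: dag A.
Proof. by apply/matrixP => i j; rewrite !mxE rmorphM. Qed.

Lemma dagK m n (A : 'M_(m, n)) : dag (dag A) = A.
Proof. by apply/matrixP => i j; rewrite !mxE conjcK. Qed.

Lemma unitary_mulVmx n (V : 'M[C]_n) : unitary V -> dag V *m V = 1%:M.
Proof. exact: mulmx1C. Qed.

Lemma unitary1 n : @unitary R n 1%:M.
Proof. by rewrite /unitary -/(dag _) dag1 mulmx1. Qed.

Lemma unitary_mul n (U V : 'M[C]_n) : unitary U -> unitary V -> unitary (U *m V).
Proof.
rewrite /unitary -!/(dag _) => UU VV.
by rewrite dag_mul mulmxA -(mulmxA U) VV mulmx1.
Qed.

Lemma unitary_dag n (V : 'M[C]_n) : unitary V -> unitary (dag V).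
Proof. by move=> UV; rewrite /unitary -/(dag _) dagK unitary_mulVmx. Qed.

Lemma unitary_diag m n (U : 'M[C]_m) (V : 'M[C]_n) :
  unitary U -> unitary V -> unitary (block_mx U 0 0 V).
Proof.
rewrite /unitary -!/(dag _) => UU VV.
by rewrite dag_block !dag0 mulmx_block UU VV !(mul0mx, mulmx0) !(addr0, add0r)
   -scalar_mx_block.
Qed.

(** Orthogonal projection onto the basis states satisfying [P]; halting measurements and tests on
    the written output both take this form. *)
Definition pmx n (P : pred 'I_n) : 'M[C]_n :=
  \matrix_(i, j) ((i == j) && P i)%:R.

Lemma pmxE n (P : pred 'I_n) i j : pmx P i j = ((i == j) && P i)%:R.
Proof. exact: mxE. Qed.

Lemma eq_pmx n (P Q : pred 'I_n) : P =1 Q -> pmx P = pmx Q.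
Proof. by move=> PQ; apply/matrixP => i j; rewrite !pmxE PQ. Qed.

Lemma mul_rV_pmx m n (u : 'M[C]_(m, n)) P i p :
  (u *m pmx P) i p = if P p then u i p else 0.
Proof.
rewrite mxE (bigD1 p) //= big1 => [|j jp]; last first.
  by rewrite pmxE (negPf jp) mulr0.
by rewrite pmxE eqxx addr0 /=; case: (P p); rewrite ?mulr1 ?mulr0.
Qed.

Lemma pmx_mul n (P Q : pred 'I_n) : pmx P *m pmx Q = pmx (fun p => P p && Q p).
Proof.
apply/matrixP => i j; rewrite mul_rV_pmx !pmxE.
by case: eqP => [->|_]; case: (Q _); rewrite ?andbT ?andbF.
Qed.

Lemma pmxT n : pmx (fun _ : 'I_n => true) = 1%:M.
Proof. by apply/matrixP => i j; rewrite pmxE mxE andbT. Qed.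

Lemma pmx0 n : pmx (fun _ : 'I_n => false) = 0.
Proof. by apply/matrixP => i j; rewrite pmxE mxE andbF. Qed.

Lemma pmxD n (P Q : pred 'I_n) : (forall p, ~~ (P p && Q p)) ->
  pmx P + pmx Q = pmx (fun p => P p || Q p).
Proof.
move=> PQ; apply/matrixP => i j; rewrite mxE !pmxE; have := PQ i.
by case: (i == j); case: (P i); case: (Q i) => //= _; rewrite ?addr0 ?add0r.
Qed.

Lemma dag_pmx n (P : pred 'I_n) : dag (pmx P) = pmx P.
Proof.
apply/matrixP => i j; rewrite !mxE rmorph_nat eq_sym.
by case: eqP => [->|].
Qed.

Lemma pmx_sum_fun (X : Type) (h : X -> bool) m n (f : 'I_m -> X) (g : 'I_n -> X) :
  pmx (fun p => h (sum_fun f g p)) =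
  block_mx (pmx (fun p => h (f p))) 0 0 (pmx (fun p => h (g p))).
Proof.
apply/matrixP => i j.
case: (split_ordP i) => i' ->; case: (split_ordP j) => j' ->;
  rewrite pmxE ?(block_mxEul, block_mxEur, block_mxEdl, block_mxEdr)
    ?(sum_fun_lshift, sum_fun_rshift) ?pmxE ?mxE;
  rewrite ?(inj_eq (@lshift_inj _ _)) ?(inj_eq (@rshift_inj _ _)) //.
- by rewrite eq_lrshift.
- by rewrite eq_rlshift.
Qed.

Definition norm2 n (u : 'rV[C]_n) : R := \sum_p sqmod (u 0 p).

Lemma sqmodC (z : C) : (sqmod z)%:C = z * conjc z.
Proof.
case: z => a b; apply/eqP; rewrite eq_complex /sqmod /=.
by apply/andP; split; apply/eqP; ring.
Qed.

Lemma sqmodM (c z : C) : sqmod (c * z) = sqmod c * sqmod z.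
Proof. by case: c => a b; case: z => x y; rewrite /sqmod /=; ring. Qed.

Lemma norm2C n (u : 'rV[C]_n) : (norm2 u)%:C = (u *m dag u) 0 0.
Proof.
rewrite /norm2 mxE (rmorph_sum (real_complex R)); apply: eq_bigr => p _.
by rewrite !mxE -sqmodC.
Qed.

Lemma mulmx_dag_row n (w : 'rV[C]_n) : w *m dag w = (norm2 w)%:C%:M.
Proof. by apply/matrixP => i j; rewrite !ord1 -norm2C mxE eqxx. Qed.

Lemma norm2_unitary n (V : 'M[C]_n) u : unitary V -> norm2 (u *m V) = norm2 u.
Proof.
move=> UV; apply: (@complexI R); rewrite !norm2C dag_mul mulmxA -(mulmxA u).
by rewrite [V *m _]UV mulmx1.
Qed.

Lemma norm2_0 n : norm2 (0 : 'rV_n) = 0.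
Proof. by apply: big1 => p _; rewrite mxE /sqmod /= expr0n addr0. Qed.

Lemma norm2_scale n c (u : 'rV_n) : norm2 (c *: u) = sqmod c * norm2 u.
Proof. by rewrite mulr_sumr; apply: eq_bigr => p _; rewrite mxE sqmodM. Qed.

Lemma norm2_row_mx m n (u : 'rV_m) (v : 'rV_n) :
  norm2 (row_mx u v) = norm2 u + norm2 v.
Proof.
rewrite /norm2 big_split_ord; congr (_ + _); apply: eq_bigr => p _.
  by rewrite row_mxEl.
by rewrite row_mxEr.
Qed.

Lemma norm2_pmx n (u : 'rV_n) P : norm2 (u *m pmx P) = \sum_(p | P p) sqmod (u 0 p).
Proof.
rewrite [RHS]big_mkcond; apply: eq_bigr => p _; rewrite mul_rV_pmx.
by case: ifP => // _; rewrite /sqmod /= expr0n addr0.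
Qed.

Lemma delta_lshift m n (i : 'I_m) :
  delta_mx 0 (lshift n i) = row_mx (delta_mx 0 i) 0 :> 'rV[C]_(m + n).
Proof.
apply/rowP => j; case: (split_ordP j) => j' ->; rewrite ?row_mxEl ?row_mxEr !mxE.
  by rewrite (inj_eq (@lshift_inj _ _)).
by rewrite eq_rlshift andbF.
Qed.

Lemma norm2_delta n (i : 'I_n) : norm2 (delta_mx 0 i) = 1.
Proof.
rewrite /norm2 (bigD1 i) //= big1 => [|j ji]; rewrite mxE /= ?(negPf ji).
  by rewrite eqxx /sqmod /= expr0n expr1n !addr0.
by rewrite /sqmod /= expr0n addr0.
Qed.

End Linear.

(** * Halting measurements as coordinate projections *)

Section Measurement.
Variable R : realType.
Local Notation C := R[i].

Definition kmx n (kd : 'I_n -> skind) (k : skind) : 'M[C]_n :=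
  pmx R (fun p => skind_eqb (kd p) k).

Lemma skind_eqP k l : reflect (k = l) (skind_eqb k l).
Proof. by case: k; case: l; constructor. Qed.

Lemma row_if_pmx n (P : pred 'I_n) (u : 'rV[C]_n) :
  \row_p (if P p then u 0 p else 0) = u *m pmx R P.
Proof. by apply/rowP => p; rewrite mul_rV_pmx mxE. Qed.

Lemma norm2_kinds n (kd : 'I_n -> skind) (u : 'rV[C]_n) :
  norm2 u = norm2 (u *m kmx kd Acc) + norm2 (u *m kmx kd Rej) + norm2 (u *m kmx kd Non).
Proof.
rewrite !norm2_pmx /norm2 3!(big_mkcond (fun p => skind_eqb _ _)) /= -!big_split /=.
by apply: eq_bigr => p _; case: (kd p); rewrite /= !(addr0, add0r).
Qed.

Lemma kmx_sum_fun m n (kd : 'I_m -> skind) (ld : 'I_n -> skind) k :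
  kmx (sum_fun kd ld) k = block_mx (kmx kd k) 0 0 (kmx ld k).
Proof. exact: (pmx_sum_fun R (skind_eqb^~ k)). Qed.

Lemma kmx_cst n l k : kmx (fun _ : 'I_n => l) k = (skind_eqb l k)%:R%:M.
Proof. by rewrite /kmx; case: (skind_eqb l k); rewrite ?pmxT ?pmx0 // raddf0. Qed.

Lemma kmx_idem n (kd : 'I_n -> skind) k : kmx kd k *m kmx kd k = kmx kd k.
Proof. by rewrite pmx_mul; apply: eq_pmx => p; rewrite andbb. Qed.

(** The entrywise condition on the end marker becomes a matrix identity, which block multiplication
    can use and establish. *)
Lemma end_mxP n (kd : 'I_n -> skind) (V : 'M[C]_n) :
  (forall q p, kd q = Non -> kd p = Non -> V q p = 0) <->
  kmx kd Non *m V *m kmx kd Non = 0.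
Proof.
have entry q p : (kmx kd Non *m V *m kmx kd Non) q p =
    if skind_eqb (kd p) Non && skind_eqb (kd q) Non then V q p else 0.
  rewrite mul_rV_pmx; case: ifP => //= _.
  rewrite mxE (bigD1 q) //= big1 => [|i iq]; last first.
    by rewrite pmxE eq_sym (negPf iq) mul0r.
  by rewrite pmxE eqxx addr0 /=; case: ifP; rewrite ?mul1r ?mul0r.
split=> [VN|/matrixP V0 q p qN pN].
  apply/matrixP => q p; rewrite entry mxE.
  by case: ifP => // /andP[/skind_eqP pN /skind_eqP qN]; apply: VN.
by have := V0 q p; rewrite entry qN pN mxE.
Qed.

End Measurement.

(** * Runs of automata, conservation of mass, complementation *)

Section Runs.
Variables (R : realType) (S : Type).
Implicit Type M : qfa R S.

(** Leaving the counted projection [P] free lets one recursion measure acceptance, rejection, or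
    halting with a given verdict. *)
Fixpoint halt_run M (P : 'M[R[i]]_(qfa_n M)) (psi : 'rV_(qfa_n M)) (s : seq (tsym S)) : R :=
  match s with
  | [::] => 0
  | a :: s' => norm2 (psi *m qfa_V M a *m P) +
               halt_run P (psi *m qfa_V M a *m kmx R (qfa_kind M) Non) s'
  end.

Definition input (v : seq S) : seq (tsym S) := map (@Sym S) v ++ [:: REnd].

Lemma qfa_acc_runE M psi s :
  qfa_acc_run psi s = halt_run (kmx R (qfa_kind M) Acc) psi s.
Proof.
elim: s psi => //= a s IH psi.
by rewrite norm2_pmx -IH -row_if_pmx.
Qed.

Lemma halt_run_scale M P c psi s :
  @halt_run M P (c *: psi) s = sqmod c * halt_run P psi s.
Proof.
elim: s psi => [|a s IH] psi /=; first by rewrite mulr0.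
by rewrite -!scalemxAl norm2_scale IH mulrDr.
Qed.

Lemma halt_run0 M psi s : @halt_run M 0 psi s = 0.
Proof. by elim: s psi => //= a s IH psi; rewrite mulmx0 norm2_0 IH addr0. Qed.

Lemma qfa_wf_end M : qfa_wf M ->
  kmx R (qfa_kind M) Non *m qfa_V M REnd *m kmx R (qfa_kind M) Non = 0.
Proof. by case=> _ /end_mxP. Qed.

(** Unitaries preserve the norm and each measurement splits it; a non-halting vector that meets the
    end marker leaves no non-halting part. *)
Lemma halt_run_total M psi s : qfa_wf M ->
  psi *m kmx R (qfa_kind M) Non = psi ->
  halt_run (kmx R (qfa_kind M) Acc) psi (s ++ [:: REnd]) +
  halt_run (kmx R (qfa_kind M) Rej) psi (s ++ [:: REnd]) = norm2 psi.
Proof.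
move=> Mwf; have [UV _] := Mwf.
elim: s psi => [|a s IH] psi psiN /=.
  rewrite !addr0 -[RHS](norm2_unitary _ (UV REnd)) [RHS](norm2_kinds (qfa_kind M)).
  rewrite -{5}psiN -!mulmxA (mulmxA (kmx _ _ _)) qfa_wf_end // mulmx0 norm2_0.
  by rewrite addr0.
rewrite addrACA IH; last by rewrite -mulmxA kmx_idem.
by rewrite -norm2_kinds norm2_unitary.
Qed.

(** Here [psi] may have halting components: the measurement after [LEnd] leaves a non-halting
    vector, from which mass is conserved as before. *)
Lemma halt_run_input M psi v : qfa_wf M ->
  halt_run (kmx R (qfa_kind M) Acc) psi (LEnd :: input v) +
  halt_run (kmx R (qfa_kind M) Rej) psi (LEnd :: input v) = norm2 psi.
Proof.
move=> Mwf; have [UV _] := Mwf.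
rewrite /= addrACA halt_run_total //; last by rewrite -mulmxA kmx_idem.
by rewrite -norm2_kinds norm2_unitary.
Qed.

Definition flip_kind k := match k with Acc => Rej | Rej => Acc | Non => Non end.

Definition flip M : qfa R S :=
  QFA (qfa_V M) (qfa_q0 M) (fun p => flip_kind (qfa_kind M p)).

Lemma kmx_flip M k :
  kmx R (qfa_kind (flip M)) k = kmx R (qfa_kind M) (flip_kind k).
Proof. by apply: eq_pmx => p /=; case: (qfa_kind M p); case: k. Qed.

Lemma flip_wf M : qfa_wf M -> qfa_wf (flip M).
Proof.
case=> UV VN; split=> //= q p qN pN.
by apply: VN; [case: (qfa_kind M q) qN | case: (qfa_kind M p) pN].
Qed.

Lemma qfa_prob_flip M v : qfa_wf M -> qfa_prob (flip M) v = 1 - qfa_prob M v.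
Proof.
move=> Mwf; rewrite -(@norm2_delta R _ (qfa_q0 M)) -(halt_run_input _ v Mwf).
rewrite /qfa_prob !qfa_acc_runE addrAC subrr add0r kmx_flip /tape -/(input v).
elim: (LEnd :: input v) (delta_mx 0 _) => //= a s IH psi.
by rewrite IH kmx_flip.
Qed.

End Runs.

(** * A fair quantum coin between two automata *)

Section Mix.
Variables (R : realType) (S : Type) (M N : qfa R S).
Local Notation C := R[i].
Local Notation m := (qfa_n M).
Local Notation n := (qfa_n N).

Let u : 'rV[C]_(m + n) := row_mx (delta_mx 0 (qfa_q0 M)) (- delta_mx 0 (qfa_q0 N)).
(** [dag u *m u] is twice the projection onto the line of [u], so the coin multiplies [u] by 1 - 2k
    = i. *)
Let k : C := 2^-1 +i* (- 2^-1).

(* On span(q0, q0') this is a square root of NOT; it fixes the orthogonal complement. *)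
Definition coin : 'M[C]_(m + n) := 1%:M - k *: (dag u *m u).

Lemma norm2_u : norm2 u = 2.
Proof.
rewrite norm2_row_mx -scaleN1r norm2_scale !norm2_delta /sqmod /= mulr1.
by ring.
Qed.

Lemma coin_unitary : unitary coin.
Proof.
rewrite /unitary -/(dag _); set P := dag u *m u.
have dagP : dag P = P by rewrite dag_mul dagK.
have PP : P *m P = 2 *: P.
  rewrite /P mulmxA -(mulmxA (dag u)) mulmx_dag_row norm2_u mul_mx_scalar -scalemxAl.
  by rewrite rmorph_nat.
have -> : dag coin = 1%:M - conjc k *: P.
  by rewrite dagB dagZ dagP dag1.
rewrite mulmxBl !mulmxBr !mul1mx mulmx1 -!scalemxAl -scalemxAr PP !scalerA.
(* Up to sign, the coefficient of [P] is k + conj k - 2 k conj k = 1 - 1. *)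
rewrite -scalerBl -addrA -opprD -scalerDl [X in X *: P](_ : _ = 0) ?scale0r ?subr0 //.
by apply/eqP; rewrite eq_complex /=; apply/andP; split; apply/eqP; field.
Qed.

Definition mix : qfa R S :=
  @QFA R S (m + n)
    (fun a => (if a is LEnd then coin else 1%:M) *m block_mx (qfa_V M a) 0 0 (qfa_V N a))
    (lshift n (qfa_q0 M)) (sum_fun (qfa_kind M) (qfa_kind N)).

Lemma mix_wf : qfa_wf M -> qfa_wf N -> qfa_wf mix.
Proof.
move=> Mwf Nwf; have [[UM _] [UN _]] := (Mwf, Nwf); split=> [a|].
  apply: unitary_mul; last exact: unitary_diag.
  by case: a => [x||]; [exact: unitary1 | exact: coin_unitary | exact: unitary1].
apply/end_mxP; rewrite /= mul1mx !kmx_sum_fun !mulmx_block.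
rewrite !(mulmx0, mul0mx, addr0, add0r) !qfa_wf_end //.
by rewrite block_mx0.
Qed.

Lemma coin_q0 : (delta_mx 0 (lshift n (qfa_q0 M)) : 'rV_(m + n)) *m coin =
  row_mx ((2^-1 +i* 2^-1) *: delta_mx 0 (qfa_q0 M)) (k *: delta_mx 0 (qfa_q0 N)).
Proof.
rewrite delta_lshift mulmxBr mulmx1 -scalemxAr mulmxA /u dag_row_mx mul_row_col.
rewrite mul0mx addr0 mulmx_dag_row norm2_delta mul1mx.
rewrite scale_row_mx opp_row_mx add_row_mx add0r scalerN opprK -{1}[delta_mx _ _]scale1r -scalerBl.
congr (row_mx (_ *: _) _); apply/eqP; rewrite eq_complex /=; apply/andP.
by split; apply/eqP; field.
Qed.

(** The coin acts at [LEnd] only; on the rest of the tape every step is block diagonal, so the two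
    halves do not interfere. *)
Lemma halt_run_mix l x y v :
  @halt_run R S mix (kmx R (qfa_kind mix) l) (row_mx x y) (input v) =
  halt_run (kmx R (qfa_kind M) l) x (input v) +
  halt_run (kmx R (qfa_kind N) l) y (input v).
Proof.
have step a z t l' : a <> LEnd -> row_mx z t *m qfa_V mix a *m kmx R (qfa_kind mix) l' =
   row_mx (z *m qfa_V M a *m kmx R (qfa_kind M) l')
          (t *m qfa_V N a *m kmx R (qfa_kind N) l').
  move=> aL; have -> : qfa_V mix a = block_mx (qfa_V M a) 0 0 (qfa_V N a).
    by case: a aL => [b||] // _; rewrite /= mul1mx.
  by rewrite kmx_sum_fun !mul_row_block !(mulmx0, addr0, add0r).
elim: v x y => [|a v IH] x y; rewrite /= !step // norm2_row_mx.
  by rewrite !addr0.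
by rewrite IH addrACA.
Qed.

Lemma qfa_prob_mix v : qfa_prob mix v = (qfa_prob M v + qfa_prob N v) / 2.
Proof.
rewrite /qfa_prob !qfa_acc_runE /tape -!/(input v) /= mulmxA coin_q0.
rewrite !kmx_sum_fun !mul_row_block !(mulmx0, addr0, add0r).
rewrite -!kmx_sum_fun norm2_row_mx.
rewrite (halt_run_mix Acc) -!scalemxAl !norm2_scale !halt_run_scale.
have -> : sqmod (2^-1 +i* 2^-1 : C) = 2^-1 by rewrite /sqmod /=; field.
have -> : sqmod k = 2^-1 by rewrite /sqmod /=; field.
by field.
Qed.

End Mix.

(** * Transducer steps as matrix products *)

Section TransducerRun.
Variables (R : realType) (S1 : Type) (S2 : eqType) (T : qfst R S1 S2).
Local Notation C := R[i].
Local Notation n := (qfst_n T).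

(** The output depends on the state before the step, so the test on it stands to the left of the
    unitary. *)
Lemma qvec_evolveE a (psi : qvec T) x :
  qvec_evolve a psi x =
  (\sum_(k < (size x).+1)
     psi (take k x) *m pmx R (fun q => take k x ++ qfst_f T a q == x)) *m qfst_V T a.
Proof.
rewrite mulmx_suml; apply: eq_bigr => k _.
rewrite [RHS]mulmx_sum_row; apply: eq_bigr => q _; rewrite mul_rV_pmx.
by case: ifP => // _; rewrite scale0r.
Qed.

Lemma acc_massE (psi : qvec T) x :
  acc_mass psi x = norm2 (psi x *m kmx R (qfst_kind T) Acc).
Proof. by rewrite norm2_pmx. Qed.

Lemma qvec_proj_nonE (psi : qvec T) x :
  qvec_proj_non psi x = psi x *m kmx R (qfst_kind T) Non.
Proof. exact: row_if_pmx. Qed.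

Lemma qfst_wf_end : qfst_wf T ->
  kmx R (qfst_kind T) Non *m qfst_V T REnd *m kmx R (qfst_kind T) Non = 0.
Proof. by case=> _ /end_mxP. Qed.

Definition at_nil (u : 'rV[C]_n) : qvec T := fun x => if x == [::] then u else 0.

Lemma qvec_evolve_at_nil a u x :
  qvec_evolve a (at_nil u) x =
  u *m pmx R (fun q => qfst_f T a q == x) *m qfst_V T a.
Proof.
rewrite qvec_evolveE big_ord_recl big1 ?addr0 => [|k _].
  by rewrite /at_nil take0.
by case: x k => [|c x] k; [case: k | rewrite /at_nil /= mul0mx].
Qed.

End TransducerRun.

(** On the image of each projection the matrix permutes the four blocks: [E] fixes them, [B] cycles
    1 to 2 to 4 to 1 and fixes 3, [D] swaps 1 with 3 and 2 with 4. *)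
Lemma shift_unitary (R : realType) n (E B D : 'M[R[i]]_n) :
  dag E = E -> dag B = B -> dag D = D ->
  E *m E = E -> B *m B = B -> D *m D = D ->
  E *m B = 0 -> B *m E = 0 -> E *m D = 0 -> D *m E = 0 -> B *m D = 0 -> D *m B = 0 ->
  E + B + D = 1%:M ->
  unitary (block_mx (block_mx E B 0 E) (block_mx D 0 0 (B + D))
                    (block_mx D 0 B D) (block_mx (E + B) 0 0 E)).
Proof.
move=> dE dB dD EE BB DD EB BE ED DE BD DB EBD.
rewrite /unitary -/(dag _) !dag_block !dagD !dag0 dE dB dD.
rewrite !(mulmx_block, add_block_mx, mulmx0, mul0mx, addr0, add0r).
rewrite !(mulmxDl, mulmxDr, EE, BB, DD, EB, BE, ED, DE, BD, DB, addr0, add0r).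
rewrite [RHS]scalar_mx_block !(scalar_mx_block n n) -!block_mx0 -EBD.
by congr (block_mx (block_mx _ _ _ _) _ _ (block_mx _ _ _ _));
  rewrite addrC ?addrA // addrC addrA.
Qed.

(** * An automaton for the probability of a one-letter output *)

Section Simulation.
Variables (R : realType) (S1 : Type) (S2 : eqType) (T : qfst R S1 S2) (b : S2).
Local Notation C := R[i].
Local Notation n := (qfst_n T).

Let skip a : 'M[C]_n := pmx R (fun q => qfst_f T a q == [::]).
Let emit a : 'M[C]_n := pmx R (fun q => qfst_f T a q == [:: b]).
Let dead a : 'M[C]_n :=
  pmx R (fun q => ~~ ((qfst_f T a q == [::]) || (qfst_f T a q == [:: b]))).

(* Blocks: output tape [::], output tape [:: b], and two halting blocks that
   receive the parts of the former two whose output is no longer a prefix of [:: b]. *)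
Definition sim_shift a : 'M[C]_(n + n + (n + n)) :=
  block_mx (block_mx (skip a) (emit a) 0 (skip a))
           (block_mx (dead a) 0 0 (emit a + dead a))
           (block_mx (dead a) 0 (emit a) (dead a))
           (block_mx (skip a + emit a) 0 0 (skip a)).

Lemma sim_shift_unitary a : unitary (sim_shift a).
Proof.
apply: shift_unitary; rewrite ?dag_pmx // ?pmx_mul.
- by apply: eq_pmx => q; rewrite andbb.
- by apply: eq_pmx => q; rewrite andbb.
- by apply: eq_pmx => q; rewrite andbb.
- by rewrite -pmx0; apply: eq_pmx => q; case: eqP => [->|].
- by rewrite -pmx0; apply: eq_pmx => q; case: eqP => [->|].
- by rewrite -pmx0; apply: eq_pmx => q; do !case: eqP.
- by rewrite -pmx0; apply: eq_pmx => q; do !case: eqP.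
- by rewrite -pmx0; apply: eq_pmx => q; do !case: eqP.
- by rewrite -pmx0; apply: eq_pmx => q; do !case: eqP.
rewrite !pmxD => [|q|q]; first by rewrite -pmxT; apply: eq_pmx => q; rewrite orbN.
  by rewrite andbN.
by case: eqP => [->|].
Qed.

(** Halting with an empty tape counts as rejection, so only the block of [[:: b]] keeps accepting
    states. The last two blocks halt at once, so the identity suffices there. *)
Definition sim : qfa R S1 :=
  @QFA R S1 (n + n + (n + n))
    (fun a => sim_shift a *m block_mx (block_mx (qfst_V T a) 0 0 (qfst_V T a)) 0 0 1%:M)
    (lshift (n + n) (lshift n (qfst_q0 T)))
    (sum_fun (sum_fun (fun p => if qfst_kind T p is Non then Non else Rej) (qfst_kind T))
             (sum_fun (fun=> Rej) (fun=> Rej))).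

Lemma kmx_sim_Acc : kmx R (qfa_kind sim) Acc =
  block_mx (block_mx 0 0 0 (kmx R (qfst_kind T) Acc)) 0 0 0.
Proof.
rewrite !kmx_sum_fun kmx_cst /= raddf0 block_mx0 /kmx (@eq_pmx _ _ _ (fun=> false)) ?pmx0 //.
by move=> p; case: (qfst_kind T p).
Qed.

Lemma kmx_sim_Non : kmx R (qfa_kind sim) Non =
  block_mx (block_mx (kmx R (qfst_kind T) Non) 0 0 (kmx R (qfst_kind T) Non)) 0 0 0.
Proof.
rewrite !kmx_sum_fun kmx_cst /= raddf0 block_mx0 /kmx.
rewrite (@eq_pmx _ _ _ (fun p => skind_eqb (qfst_kind T p) Non)) //.
by move=> p; case: (qfst_kind T p).
Qed.

Lemma sim_wf : qfst_wf T -> qfa_wf sim.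
Proof.
move=> Twf; have [UT _] := Twf; split=> [a|].
  apply: unitary_mul; first exact: sim_shift_unitary.
  by apply: unitary_diag; [exact: unitary_diag | exact: unitary1].
apply/end_mxP; rewrite kmx_sim_Non /=.
rewrite !(mulmx_block, add_block_mx, mulmx1, mulmx0, mul0mx, addr0, add0r).

(* Diagonal projections commute, so the output test moves to the outside and the end marker
   condition of [T] applies. *)
have comm P : kmx R (qfst_kind T) Non *m (pmx R P *m qfst_V T REnd) *m kmx R (qfst_kind T) Non = 0.
  have -> : kmx R (qfst_kind T) Non *m (pmx R P *m qfst_V T REnd) =
            pmx R P *m (kmx R (qfst_kind T) Non *m qfst_V T REnd).
    rewrite !mulmxA !pmx_mul; congr (_ *m _).
    by apply: eq_pmx => p; rewrite andbC.
  by rewrite -mulmxA qfst_wf_end // mulmx0.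
by rewrite !comm !block_mx0.
Qed.

(** The new components at [[::]] and [[:: b]] depend only on the old ones at these two tapes, and
    the measurement empties the halting blocks before each step. *)
Lemma qfa_run_sim (psi : qvec T) s :
  halt_run (kmx R (qfa_kind sim) Acc)
    (row_mx (row_mx (psi [::]) (psi [:: b])) 0 : 'rV_(qfa_n sim)) s =
  qfst_acc_run psi s [:: b].
Proof.
elim: s psi => //= a s IH psi.
rewrite -IH acc_massE !qvec_proj_nonE !qvec_evolveE /= 2!big_ord_recr !big_ord1 /=.
have -> : pmx R (fun q => [:: b] ++ qfst_f T a q == [:: b]) = skip a.
  by apply: eq_pmx => q; rewrite eqseq_cons eqxx.
rewrite kmx_sim_Acc kmx_sim_Non.
rewrite !(mulmxA, mul_row_block, add_row_mx, mulmx1, mulmx0, mul0mx, addr0, add0r).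
by rewrite big_ord0 add0r !norm2_row_mx !norm2_0 addr0 add0r.
Qed.

Lemma qfa_prob_sim v : qfa_prob sim v = qfst_prob T v [:: b].
Proof.
rewrite /qfa_prob qfa_acc_runE /qfst_prob -qfa_run_sim.
have -> : delta_mx 0 (qfa_q0 sim) =
    row_mx (row_mx (qvec_init T [::]) (qvec_init T [:: b])) 0 :> 'rV_(n + n + (n + n)).
  by rewrite /qvec_init /= !delta_lshift.
by [].
Qed.

End Simulation.

(** * A transducer that writes the verdict of an automaton *)

Section Writer.
Variables (R : realType) (S : Type) (M : qfa R S).
Local Notation C := R[i].
Local Notation n := (qfa_n M).
Local Notation Vend := (qfa_V M REnd).

Let halting : pred 'I_n := fun p => ~~ skind_eqb (qfa_kind M p) Non.
Let Pn := kmx R (qfa_kind M) Non.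
Let Ph := pmx R halting.
(** The letter [false] encodes 0. Non-halting states also get [true], but for a well-formed [M] they
    carry no amplitude when a verdict is written. *)
Let verdict (p : 'I_n) : seq bool := [:: ~~ skind_eqb (qfa_kind M p) Acc].

Lemma kmx_NonD : Pn + Ph = 1%:M.
Proof.
rewrite pmxD => [|p]; last by rewrite /halting andbN.
by rewrite -pmxT; apply: eq_pmx => p; rewrite /halting orbN.
Qed.

Lemma Pn_Ph : Pn *m Ph = 0.
Proof. by rewrite pmx_mul -pmx0; apply: eq_pmx => p; rewrite /halting andbN. Qed.

Lemma Ph_Pn : Ph *m Pn = 0.
Proof. by rewrite pmx_mul -pmx0; apply: eq_pmx => p; rewrite /halting andNb. Qed.

Lemma Ph_idem : Ph *m Ph = Ph.
Proof. by rewrite pmx_mul; apply: eq_pmx => p; rewrite andbb. Qed.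

(* If y is the state of M just before a measurement, the transducer is in
   (y Pn Vend, y Ph | 0, 0): the surviving part is stored after a speculative
   reading of the right end marker, so that the verdict of M on it is readable
   off the basis state before the last step. Halted parts wait in the second block
   for one step, during which their verdict is written, then halt in the last block. *)
Definition writer_route : 'M[C]_(n + n + (n + n)) :=
  block_mx (block_mx Pn Ph 0 0) (block_mx 0 0 0 1%:M)
           (block_mx 0 0 Ph Pn) (block_mx 1%:M 0 0 0).

(** At [LEnd] nothing has been stored yet, so there is no speculative [Vend] to undo. *)
Definition resume (a : tsym S) : 'M[C]_n :=
  if a is Sym _ then dag Vend *m qfa_V M a else qfa_V M a.

(** The swap at [REnd] sends the whole non-halting half to the accepting half, as the end marker
    condition demands. *)
Definition writer_V a : 'M[C]_(n + n + (n + n)) :=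
  if a is REnd then block_mx 0 1%:M 1%:M 0
  else block_mx (block_mx (resume a) 0 0 1%:M) 0 0 1%:M *m writer_route
         *m block_mx (block_mx Vend 0 0 1%:M) 0 0 1%:M.

(** Every halting state accepts: rejection by [M] is expressed by the output alone. *)
Definition writer : qfst R S bool :=
  @QFST R S bool (n + n + (n + n)) writer_V
    (fun a => sum_fun
       (sum_fun (fun p => if a is REnd then verdict p else [::]) verdict)
       (sum_fun (fun=> [::]) (fun=> [::])))
    (lshift (n + n) (lshift n (qfa_q0 M)))
    (sum_fun (sum_fun (fun=> Non) (fun=> Non)) (sum_fun (fun=> Acc) (fun=> Acc))).

Lemma writer_route_unitary : unitary writer_route.
Proof.
rewrite /unitary -/(dag _) !dag_block !dag_pmx !dag0 !dag1.
rewrite !(mulmx_block, add_block_mx, mulmx1, mulmx0, mul0mx, addr0, add0r).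
rewrite !kmx_idem !Ph_idem !Pn_Ph !Ph_Pn (addrC Ph) kmx_NonD !addr0 !block_mx0.
by rewrite -!scalar_mx_block.
Qed.

Lemma kmx_writer_Acc : kmx R (qfst_kind writer) Acc = block_mx 0 0 0 1%:M.
Proof.
by rewrite !kmx_sum_fun !kmx_cst /= raddf0 block_mx0 -scalar_mx_block.
Qed.

Lemma kmx_writer_Non : kmx R (qfst_kind writer) Non = block_mx 1%:M 0 0 0.
Proof.
by rewrite !kmx_sum_fun !kmx_cst /= raddf0 block_mx0 -scalar_mx_block.
Qed.

Lemma writer_wf : qfa_wf M -> qfst_wf writer.
Proof.
case=> UV _; split=> [a|].
  have pad U : unitary U -> unitary (block_mx (block_mx U 0 0 (1%:M : 'M[C]_n)) 0 0
                                       (1%:M : 'M[C]_(n + n))).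
    by move=> UU; do 2! [apply: unitary_diag (unitary1 _ _)].
  have route X : unitary X -> unitary (block_mx (block_mx X 0 0 1%:M) 0 0 1%:M *m
      writer_route *m block_mx (block_mx Vend 0 0 1%:M) 0 0 1%:M).
    move=> UX; apply: unitary_mul; last exact/pad/UV.
    by apply: unitary_mul; [exact: pad | exact: writer_route_unitary].
  case: a => [c||] /=.
  - exact/route/(unitary_mul (unitary_dag (UV _)) (UV _)).
  - exact/route/UV.
  - rewrite /unitary -/(dag _) dag_block dag0 dag1 mulmx_block.
    by rewrite !(mulmx1, mulmx0, mul0mx, addr0, add0r) -scalar_mx_block.
apply/end_mxP; rewrite kmx_writer_Non /=.
by rewrite !(mulmx_block, mulmx1, mulmx0, mul0mx, addr0, add0r) block_mx0.
Qed.

Let says w := pmx R (fun p => verdict p == w).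
(** Counting with this projection in runs of [M] gives the probability that the transducer outputs
    [w]. *)
Let target w := Ph *m says w.

Lemma pmx_writer_f a w : pmx R (fun q => qfst_f writer a q == w) =
  block_mx (block_mx (pmx R (fun p => (if a is REnd then verdict p else [::]) == w)) 0 0 (says w))
    0 0 ([::] == w)%:R%:M.
Proof.
rewrite !(pmx_sum_fun R (eq_op^~ w)); congr block_mx.
rewrite [RHS]scalar_mx_block; congr block_mx; case: (_ == w);
  by rewrite ?pmxT ?pmx0 // raddf0.
Qed.

Definition store (y : 'rV[C]_n) : 'rV[C]_(n + n + (n + n)) :=
  row_mx (row_mx (y *m Pn *m Vend) (y *m Ph)) 0.

Lemma writer_step a x z w : a <> REnd ->
  (row_mx (row_mx x z) 0 : 'rV_(n + n + (n + n))) *m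
    pmx R (fun q => qfst_f writer a q == w) *m writer_V a =
  row_mx (row_mx (([::] == w)%:R *: x *m resume a *m Pn *m Vend)
                 (([::] == w)%:R *: x *m resume a *m Ph)) (row_mx 0 (z *m says w)).
Proof.
move=> aR; rewrite pmx_writer_f.
have -> : writer_V a = block_mx (block_mx (resume a) 0 0 1%:M) 0 0 1%:M *m writer_route
         *m block_mx (block_mx Vend 0 0 1%:M) 0 0 1%:M by case: a aR.
have -> : pmx R (fun p => (if a is REnd then verdict p else [::]) == w) =
          ([::] == w)%:R%:M.
  case: a aR => [c||] // _; case: (_ == w);
  by rewrite ?pmxT ?pmx0 // raddf0.
rewrite /writer_route; move: (says w) (resume a) => D X.
clear target; move: Pn Ph => P Q.
rewrite !(mulmxA, mul_row_block, add_row_mx, mulmx1, mulmx0, mul0mx, addr0, add0r).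
by rewrite mul_mx_scalar.
Qed.

Lemma writer_proceed a x y z : a <> REnd -> x *m resume a = y ->
  qvec_proj_non (qvec_evolve (T := writer) a (at_nil (T := writer) (row_mx (row_mx x z) 0))) =
  at_nil (T := writer) (store y).
Proof.
move=> aR xy; apply: funext => w.
rewrite qvec_proj_nonE qvec_evolve_at_nil writer_step // kmx_writer_Non.
rewrite mul_row_block !(mulmx1, mulmx0, addr0) /at_nil eq_sym.
case: eqP => _; rewrite ?scale1r ?scale0r ?xy // !mul0mx.
by rewrite !row_mx0.
Qed.

Lemma writer_mass a x z w : a <> REnd ->
  acc_mass (qvec_evolve (T := writer) a (at_nil (T := writer) (row_mx (row_mx x z) 0))) w =
  norm2 (z *m says w).
Proof.
move=> aR; rewrite acc_massE qvec_evolve_at_nil writer_step // kmx_writer_Acc.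
rewrite mul_row_block !(mulmx1, mulmx0, add0r) !norm2_row_mx !norm2_0.
by rewrite !add0r.
Qed.

(** The transducer lags one step behind: the first term is what [M] halted with at its latest
    measurement, written only now. At [REnd] it halts together with the final part, in a separate
    block, so the masses add. *)
Lemma writer_run y v w : qfa_wf M ->
  qfst_acc_run (T := writer) (at_nil (T := writer) (store y)) (input v) w =
  norm2 (y *m target w) + halt_run (target w) (y *m Pn) (input v).
Proof.
move=> Mwf; have [UV _] := Mwf.
elim: v y => [|c v IH] y /=.
  rewrite acc_massE qvec_evolve_at_nil pmx_writer_f kmx_writer_Acc /=.
  rewrite !(mulmxA, mul_row_block, add_row_mx, mulmx1, mulmx0, mul0mx, addr0, add0r).
  rewrite !norm2_row_mx norm2_0 add0r addrC; congr (_ + norm2 _).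
  (* After [Vend] no non-halting amplitude is left, so inserting [Pn + Ph] = 1 supplies the factor
     [Ph] of [target]. *)
  have yPnV : y *m Pn *m Vend *m Pn = 0.
    by rewrite -!mulmxA (mulmxA Pn) qfa_wf_end // mulmx0.
  by rewrite -{1}[y *m Pn *m Vend]mulmx1 -kmx_NonD mulmxDr yPnV add0r.
rewrite writer_mass // (@writer_proceed _ _ (y *m Pn *m qfa_V M (Sym c))) //; last first.
  by rewrite /resume !mulmxA -(mulmxA (y *m Pn)) [Vend *m _]UV mulmx1.
by rewrite IH !mulmxA.
Qed.

Lemma qfst_prob_writer v w : qfa_wf M ->
  qfst_prob writer v w = halt_run (target w) (delta_mx 0 (qfa_q0 M)) (LEnd :: input v).
Proof.
move=> Mwf; rewrite /qfst_prob /tape -/(input v).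
have -> : qvec_init writer = at_nil (T := writer) (row_mx (row_mx (delta_mx 0 (qfa_q0 M)) 0) 0).
  by rewrite /qvec_init /at_nil /= !delta_lshift.
rewrite [LHS]/= writer_mass // mul0mx norm2_0 add0r.
by rewrite (@writer_proceed _ _ (delta_mx 0 (qfa_q0 M) *m qfa_V M LEnd)) // writer_run.
Qed.

Lemma target_false : target [:: false] = kmx R (qfa_kind M) Acc.
Proof.
by rewrite /target pmx_mul; apply: eq_pmx => p; rewrite /halting /verdict; case: (qfa_kind M p).
Qed.

Lemma target_true : target [:: true] = kmx R (qfa_kind M) Rej.
Proof.
by rewrite /target pmx_mul; apply: eq_pmx => p; rewrite /halting /verdict; case: (qfa_kind M p).
Qed.

Lemma target_other w : w <> [:: false] -> w <> [:: true] -> target w = 0.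
Proof.
move=> wf wt; rewrite /target pmx_mul -pmx0; apply: eq_pmx => p; rewrite /verdict.
rewrite andbC; case: eqP => // wE; case: skind_eqb wE => /esym //.
Qed.

End Writer.

(** * The equivalence, with explicit cutpoint and margins *)

Theorem theorem1 (R : realType) (Sigma : finType) (L : seq Sigma -> Prop) :
  (exists M : qfa R Sigma, qfa_wf M /\ qfa_accepts_bounded M L) <->
  (exists T : qfst R Sigma bool, qfst_wf T /\ computes_isolated T (lang_rel L)).
Proof.
split=> [[M [Mwf [d [d0 ML]]]] | [T [Twf [alpha [eps [_ [eps0 TL]]]]]]].
  exists (writer M); split; first exact: writer_wf.
  (* The cap 1/2 makes 0 <= 1/2 - e, as needed for the outputs other than 0 and 1, which have
     probability 0. *)
  pose e := Num.min d 2^-1.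
  have ed : e <= d by rewrite ge_min lexx.
  have e2 : e <= 2^-1 by rewrite ge_min lexx orbT.
  exists 2^-1, e; split; first by lra.
  split=> [|v w]; first by rewrite lt_min d0; lra.
  rewrite qfst_prob_writer //.
  have Tacc : qfa_prob M v =
      halt_run (kmx R (qfa_kind M) Acc) (delta_mx 0 (qfa_q0 M)) (LEnd :: input v).
    by rewrite /qfa_prob qfa_acc_runE.
  have := halt_run_input (delta_mx 0 (qfa_q0 M)) v Mwf.
  rewrite norm2_delta -Tacc => Tot.
  have [LM nLM] := ML v.
  have [->|/eqP wf] := eqVneq w [:: false].
    rewrite target_false -Tacc; split=> [[[Lv _]|[_ //]] | nR].
      by have := LM Lv; lra.
    have nL : ~ L v by move=> Lv; apply: nR; left.
    by have := nLM nL; lra.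
  have [->|/eqP wt] := eqVneq w [:: true].
    rewrite target_true; split=> [[[_ //]|[nLv _]] | nR].
      by have := nLM nLv; lra.
    (* [L] is an arbitrary predicate, so the double negation is removed classically. *)
    have Lv : L v by apply: contrapT => nLv; apply: nR; right.
    by have := LM Lv; lra.
  rewrite target_other // halt_run0; split=> [[[]|[]]//|_].
  by rewrite subr_ge0.
exists (mix (sim T false) (flip (sim T true))); split.
  by apply: mix_wf; [|apply: flip_wf]; exact: sim_wf.
(* T(0|v) and T(1|v) lie on opposite sides of the cutpoint, at least 2 [eps] apart; halving their
   difference leaves [eps], and [alpha] cancels. *)
exists eps; split=> // v.
rewrite qfa_prob_mix qfa_prob_flip; last exact: sim_wf.
rewrite !qfa_prob_sim.
have [T0 nT0] := TL v [:: false]; have [T1 nT1] := TL v [:: true].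
split=> Lv.
  have := T0 (or_introl (conj Lv erefl)).
  have : qfst_prob T v [:: true] <= alpha - eps by apply: nT1 => -[[]//|[]].
  by lra.
have := T1 (or_intror (conj Lv erefl)).
have : qfst_prob T v [:: false] <= alpha - eps by apply: nT0 => -[[]//|[]].
by lra.
Qed.
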